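(* Let $w=(w_1,\dots,w_n)$ and $v=(v_1,\dots,v_n)$ be vectors in $\mathbb{R}^n$ such that $\|w\|_2=\|v\|_2=1$, and define $\rho=\langle w,v\rangle$. Given $t,s\in\mathbb{R}$, define the following linear threshold sets: $$\mathcal{A}=\Bigl\{x\in\mathbb{R}^n:\sum_i x_iw_i>t\Bigr\},\qquad \mathcal{B}=\Bigl\{x\in\mathbb{R}^n:\sum_i x_iv_i>s\Bigr\}.$$ Then $$\mathrm{Cov}_\gamma(\mathbf{1}_{\mathcal{A}},\mathbf{1}_{\mathcal{B}})\ \ge\ c\,\frac{\mathcal{W}^{(\gamma)}_1(\mathcal{A},\mathcal{B})}{\sqrt{\log\frac{e}{\mathcal{W}^{(\gamma)}_1(\mathcal{A},\mathcal{A})}}\ \sqrt{\log\frac{e}{\mathcal{W}^{(\gamma)}_1(\mathcal{B},\mathcal{B})}}},$$ where $c>0$ is a universal constant.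
   Context: $\gamma$ is the standard Gaussian measure $N(0,I_n)$ on $\mathbb{R}^n$, and $\mathrm{Cov}_\gamma(f,g)=\mathbb{E}_\gamma[fg]-\mathbb{E}_\gamma[f]\,\mathbb{E}_\gamma[g]$. For a set $\mathcal{A}\subset\mathbb{R}^n$, the Gaussian influence of the $k$-th coordinate on $\mathcal{A}$ is $I_k^{(\gamma)}(\mathcal{A})=\mathbb{E}_\gamma[\mathbf{1}_{\mathcal{A}}\,\mathbf{x}_k]$, where $\mathbf{x}_k(x)=x_k$ is the $k$-th coordinate projection. For two such sets, $\mathcal{W}^{(\gamma)}_1(\mathcal{A},\mathcal{B})=\sum_{k=1}^n I_k^{(\gamma)}(\mathcal{A})\,I_k^{(\gamma)}(\mathcal{B})$.
   Formalization: The formal theorem adds the hypothesis ρ = ⟨w,v⟩ ≥ 0; without it the inequality fails for every c > 0 (n = 1, w = 1, v = −1, s = −t, t → ∞). *)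

(* Defs.v *)
From HB Require Import structures.
From mathcomp Require Import all_boot all_order all_algebra.
From mathcomp Require Import all_classical all_reals all_analysis.

Set Implicit Arguments.
Unset Strict Implicit.
Unset Printing Implicit Defensive.

Import Order.TTheory GRing.Theory Num.Theory.
Import numFieldNormedType.Exports.

Local Open Scope classical_set_scope.
Local Open Scope ring_scope.

(* R^n. The library's sigma-algebra on tuples is the product one, and
   [measurableTypeR R] is R with its Borel sets. *)
Notation Rn R n := (n.-tuple (measurableTypeR R)).

Section gaussian.
Context {R : realType}.

Definition consRn n (p : measurableTypeR R * Rn R n) : Rn R n.+1 :=
  [tuple of p.1 :: p.2].

Lemma measurable_consRn n : measurable_fun setT (@consRn n).
Proof. exact: measurable_cons. Qed.

HB.instance Definition _ n := @isMeasurableFun.Build _ _ _ _ (@consRn n)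
  (@measurable_consRn n).

(* N(0, I_n), the n-fold product of N(0, 1): the image of the binary product
   N(0, 1) x N(0, I_m) under R x R^m -> R^(m+1). *)
Fixpoint gaussian (n : nat) : probability (Rn R n) R :=
  if n is m.+1 then
    distribution (normal_prob (0 : R) (1 : R) \x gaussian m)%E (@consRn m)
  else dirac [tuple].

(* The values on measurable boxes, which determine [gaussian n]. *)
Lemma gaussian_box n (A : 'I_n -> set (measurableTypeR R)) :
  (forall i, measurable (A i)) ->
  gaussian n [set x | forall i, A i (tnth x i)] =
  (\prod_(i < n) normal_prob (0 : R) (1 : R) (A i))%E.
Proof.
elim: n A => [|n IHn] A mA.
  rewrite big_ord0 /= diracE mem_set//= => -[]//.
rewrite big_ord_recl /= /distribution /pushforward /=.
rewrite (_ : _ @^-1` _ =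
    A ord0 `*` [set x | forall i, A (lift ord0 i) (tnth x i)]); last first.
  apply/seteqP; split=> -[a x] /=.
    move=> h; split; first by have := h ord0; rewrite /consRn /= tnth0.
    by move=> i; have := h (lift ord0 i); rewrite /consRn /= tnthS.
  move=> [h0 h] i; rewrite /consRn /=.
  by have [j ->|->] := unliftP ord0 i; rewrite ?tnthS ?tnth0.
rewrite product_measure1E//.
  by congr (_ * _)%E; exact: (IHn (fun i => A (lift ord0 i))).
rewrite (_ : [set x | _] = \bigcap_(i in [set: 'I_n])
    ((fun x : Rn R n => tnth x i) @^-1` A (lift ord0 i))); last first.
  by apply/seteqP; split=> x /= h i; [move=> _|]; exact: h.
apply: fin_bigcap_measurable; first exact: finite_finset.
by move=> i _; rewrite -[X in measurable X]setTI; exact: measurable_tnth.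
Qed.

End gaussian.

(* The library's covariance is E[(X - E X) (Y - E Y)]. *)
Lemma covariance_indicE d (T : measurableType d) (R : realType)
    (P : probability T R) (A B : set T) :
  measurable A -> measurable B ->
  covariance P \1_A \1_B =
  ('E_P[(fun x => \1_A x * \1_B x)%R] - 'E_P[\1_A] * 'E_P[\1_B])%E.
Proof.
have l1 C : measurable C -> (\1_C : T -> R) \in Lfun P 1.
  by move=> mC; apply/Lfun1_integrable; exact: integrable_indic.
move=> mA mB; rewrite covarianceE; [by []|exact: l1|exact: l1|].
have -> : (\1_A * \1_B)%R = \1_(A `&` B) :> (T -> R) by rewrite indicI.
by apply: l1; exact: measurableI.
Qed.

Section influence.
Context {R : realType} {n : nat}.
Implicit Types (w v : Rn R n) (A B : set (Rn R n)).

Definition dotp w v : R := \sum_(i < n) tnth w i * tnth v i.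

Definition norm2 w : R := Num.sqrt (\sum_(i < n) tnth w i ^+ 2).

Definition threshold_set w (t : R) : set (Rn R n) :=
  [set x | \sum_(i < n) tnth x i * tnth w i > t].

Definition influence (k : 'I_n) A : R :=
  fine 'E_(gaussian n)[(fun x => \1_A x * tnth x k)%R]%E.

Definition W1 A B : R := \sum_(k < n) influence k A * influence k B.

End influence.

(* Main.v *)
(** Write [phi] for the density and [gamma] for the law of [N(0, 1)].
    By rotation invariance the pair of linear forms [(<x,w>, <x,v>)] has the
    law of [(X, rho X + sigma Z)] with [X], [Z] independent standard normal
    variables and [rho ^+ 2 + sigma ^+ 2 = 1]. Hence the [k]-th influence of the
    threshold set [A] is [w_k * phi t], so that [W1 A B = rho * phi t * phi s]
    and [ln (e / W1 A A) >= 1 + t ^+ 2].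

    It remains to bound the covariance below by a multiple of
    [rho * phi t * phi s / (T * b)], where [T = max 1 |t|] and [b = max 1 |s|];
    exchanging [A] and [B] if needed, [|s| <= T]. Put
    [G x = P(rho x + sigma Z > s)], a nondecreasing function of mean
    [p = gamma ]s, +oo[]. The covariance is the integral of [G - p] over
    []t, +oo[], or minus its integral over the complement; the sign of [G t - p]
    tells on which of the two sides the integrand has a constant sign, and there
    it suffices to look beyond [T] (resp. [- T]). For [x > T] every
    [z > s - rho / 2] satisfies [rho x + sigma z > s], so [G x - p] is at least
    the [gamma]-mass of an interval of length [rho / (2 b)] next to [s], which is
    of order [rho * phi s / b]; and [gamma ]T, +oo[] is of order [phi T / T]. *)

From HB Require Import structures.
Require Import Defs.
From mathcomp Require Import all_boot all_order all_algebra ring lra.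
From mathcomp Require Import all_classical all_reals all_analysis.
From mathcomp Require Import measurable_realfun.

Import Order.TTheory GRing.Theory Num.Theory.
Import numFieldNormedType.Exports.
Local Open Scope classical_set_scope.
Local Open Scope ring_scope.

(** * Rotation invariance of the planar standard normal law *)

Section standard_normal.
Context {R : realType}.
Local Notation mu := (@lebesgue_measure R).
Local Notation MR := (measurableTypeR R).

(** The Radon-Nikodym derivative of [normal_prob] agrees almost everywhere with [normal_pdf],
    because both have the same integral over every measurable set. *)
Lemma ge0_integral_normal_prob (m sigma : R) (f : MR -> \bar R) :
  measurable_fun [set: MR] f -> (forall x, 0 <= f x)%E ->
  (\int[normal_prob m sigma]_x f x =
   \int[mu]_x (f x * (normal_pdf m sigma x)%:E))%E.
Proof.
move=> mf f0; have dom := normal_prob_dominates m sigma.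
rewrite -(Radon_Nikodym_SigmaFinite.change_of_variables dom)//.
have iRN := Radon_Nikodym_SigmaFinite.f_integrable dom.
have mpdf : measurable_fun [set: R] (fun x => (normal_pdf m sigma x)%:E).
  by apply/measurable_EFinP; exact: measurable_normal_pdf.
apply: ae_eq_integral => //.
- by apply: emeasurable_funM => //; exact: measurable_int iRN.
- exact: emeasurable_funM.
- apply: ae_eqe_mul2l => /=; apply: integral_ae_eq => // E _ mE.
  by rewrite -Radon_Nikodym_SigmaFinite.f_integral.
Qed.

(** By uniqueness of Lebesgue measure it suffices to compare lengths on intervals []b, c]], whose
    preimages are []b - a, c - a]]. *)
Lemma lebesgue_measureD (a : R) (A : set MR) : measurable A ->
  pushforward mu (fun x : MR => (x + a : MR)) A = mu A.
Proof.
have ma : measurable_fun [set: MR] (fun x : MR => (x + a : MR)).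
  exact: measurable_funD.
pose f : {mfun MR >-> MR} := HB.pack (fun x : MR => (x + a : MR))
  (isMeasurableFun.Build _ _ _ _ _ ma).
move=> mA.
rewrite [RHS](@lebesgue_measure_unique R (pushforward mu f))// => _ [[b c]] _ <-.
rewrite /= /pushforward.
rewrite (_ : _ @^-1` _ = `](b - a)%R, (c - a)%R]%classic); last first.
  by apply/seteqP; split=> x /=; rewrite !in_itv/= ltrBlDr lerBrDr.
rewrite !lebesgue_measure_itv/= !lte_fin ltrD2r.
by case: ifP => // _; rewrite -!EFinB; congr (_%:E); ring.
Qed.

Lemma ge0_integral_lebesgueD (a : R) (f : MR -> \bar R) :
  measurable_fun [set: MR] f -> (forall x, 0 <= f x)%E ->
  (\int[mu]_x f (x + a)%R = \int[mu]_x f x)%E.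
Proof.
move=> mf f0.
have ma : measurable_fun [set: MR] (fun x : MR => (x + a : MR)).
  exact: measurable_funD.
transitivity (\int[pushforward mu (fun x : MR => (x + a)%R : MR)]_x f x)%E.
  by rewrite ge0_integral_pushforward.
by apply: eq_measure_integral => A mA _; exact: lebesgue_measureD.
Qed.

(** Tonelli puts the integral in [x] inside; for fixed [y] the shear is then a translation of [x] by
    [a * y]. *)
Lemma ge0_integral_shear_fst (a : R) (f : MR * MR -> \bar R) :
  measurable_fun [set: MR * MR] f -> (forall z, 0 <= f z)%E ->
  (\int[mu]_x \int[mu]_y f (x + a * y, y)%R = \int[mu]_x \int[mu]_y f (x, y))%E.
Proof.
move=> mf f0.
have mfa : measurable_fun [set: MR * MR] (fun z : MR * MR => f (z.1 + a * z.2, z.2)).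
  apply: measurableT_comp => //; apply/measurable_fun_pairP; split => /=.
    by apply: measurable_funD => //=; exact: measurable_funM.
  exact: measurable_snd.
apply: etrans (fubini_tonelli _ mfa (fun=> f0 _)) _.
apply: etrans _ (esym (fubini_tonelli _ mf f0)).
apply: eq_integral => y _.
exact: (ge0_integral_lebesgueD (a * y) (fun x => f (x, y))
  (measurableT_comp mf (measurable_pair2 y)) (fun=> f0 _)).
Qed.

Lemma ge0_integral_shear_snd (b : R) (f : MR * MR -> \bar R) :
  measurable_fun [set: MR * MR] f -> (forall z, 0 <= f z)%E ->
  (\int[mu]_x \int[mu]_y f (x, y + b * x)%R = \int[mu]_x \int[mu]_y f (x, y))%E.
Proof.
move=> mf f0; apply: eq_integral => x _.
by rewrite (ge0_integral_lebesgueD (b * x) (fun y => f (x, y)))//;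
  exact: measurableT_comp.
Qed.

Lemma measurable_linear2 (a b : R) :
  measurable_fun [set: MR * MR] (fun z : MR * MR => a * z.1 + b * z.2 : MR).
Proof. by apply: measurable_funD; apply: measurable_funM. Qed.

Lemma measurable_linear2_pair (a b c d : R) :
  measurable_fun [set: MR * MR] (fun z : MR * MR =>
    (a * z.1 + b * z.2, c * z.1 + d * z.2) : MR * MR).
Proof. by apply/measurable_fun_pairP; split; exact: measurable_linear2. Qed.

(* A rotation of angle other than [pi] is a product of three shears. *)
Lemma ge0_integral_lebesgue_rotation (c s : R) (f : MR * MR -> \bar R) :
  c ^+ 2 + s ^+ 2 = 1 -> c != -1 ->
  measurable_fun [set: MR * MR] f -> (forall z, 0 <= f z)%E ->
  (\int[mu]_x \int[mu]_y f (c * x + s * y, - s * x + c * y)%R =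
   \int[mu]_x \int[mu]_y f (x, y))%E.
Proof.
move=> cs1 cN1 mf f0.
have c1 : 1 + c != 0 by rewrite addrC addr_eq0.
(* For the angle with cosine [c] and sine [s], [a] is the tangent of the half angle. The rotation is
   the horizontal shear by [a], then the vertical shear by [- s], then the horizontal shear by [a]
   again. *)
pose a := s / (1 + c).
have m1 : measurable_fun [set: MR * MR] (fun z : MR * MR => f (z.1 + a * z.2, z.2)).
  apply: measurableT_comp => //.
  have := measurable_linear2_pair 1 a 0 1.
  by under eq_fun do rewrite mul0r add0r !mul1r.
have m2 : measurable_fun [set: MR * MR] (fun z : MR * MR =>
    f (z.1 + a * (z.2 - s * z.1), z.2 - s * z.1)).
  have := measurableT_comp m1 (measurable_linear2_pair 1 0 (- s) 1).
  apply: eq_measurable_fun => z _ /=; congr (f (_, _)); ring.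
apply: etrans _ (ge0_integral_shear_fst a f mf f0).
apply: etrans _ (ge0_integral_shear_snd (- s) _ m1 (fun=> f0 _)).
under [RHS]eq_integral do under eq_integral do rewrite mulNr.
apply: etrans _ (ge0_integral_shear_fst a _ m2 (fun=> f0 _)).
apply: eq_integral => x _; apply: eq_integral => y _.
have s2 : s ^+ 2 = (1 - c) * (1 + c).
  by apply/eqP; rewrite -subr_eq0 -subr_sqr expr1n -{1}cs1; apply/eqP; ring.
have as2 : a * s = 1 - c by rewrite /a mulrAC -expr2 s2 mulfK.
have ac : a * (1 + c) = s by rewrite /a divfK.
rewrite /=; congr (f (_, _)); last by ring: as2.
rewrite -[in LHS]ac; ring: as2.
Qed.

Lemma standard_normal_pdfE (x : R) :
  normal_pdf 0 1 x = normal_peak 1 * expR (- (x ^+ 2 / 2)).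
Proof.
by rewrite normal_pdfE ?oner_neq0// /normal_fun subr0 expr1n mulNr.
Qed.

Lemma ge0_integral_standard_normal2 (f : MR * MR -> \bar R) :
  measurable_fun [set: MR * MR] f -> (forall z, 0 <= f z)%E ->
  (\int[normal_prob 0 1 \x normal_prob 0 1]_z f z =
   \int[mu]_x \int[mu]_y
     (f (x, y) * (normal_peak 1 ^+ 2 * expR (- ((x ^+ 2 + y ^+ 2) / 2)))%:E))%E.
Proof.
move=> mf f0; rewrite fubini_tonelli1//.
rewrite ge0_integral_normal_prob//; last 2 first.
- exact: measurable_fun_fubini_tonelli_F.
- by move=> x; apply: integral_ge0.
apply: eq_integral => x _; rewrite /fubini_F.
rewrite ge0_integral_normal_prob//; last exact: measurableT_comp.
rewrite -ge0_integralZr//; last 3 first.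
- apply: emeasurable_funM; first exact: measurableT_comp.
  by apply/measurable_EFinP; exact: measurable_normal_pdf.
- by move=> y _; rewrite mule_ge0// lee_fin normal_pdf_ge0.
- by rewrite lee_fin normal_pdf_ge0.
apply: eq_integral => y _; rewrite -muleA; congr (_ * _)%E.
rewrite -EFinM; congr (_%:E).
rewrite !standard_normal_pdfE mulrDl opprD expRD; ring.
Qed.

(** The joint density depends only on [x ^+ 2 + y ^+ 2], which a rotation preserves, so it can be
    absorbed into the integrand of the Lebesgue version. *)
Lemma ge0_integral_normal_rotation (c s : R) (f : MR * MR -> \bar R) :
  c ^+ 2 + s ^+ 2 = 1 ->
  measurable_fun [set: MR * MR] f -> (forall z, 0 <= f z)%E ->
  (\int[normal_prob 0 1 \x normal_prob 0 1]_z
     f (c * z.1 + s * z.2, - s * z.1 + c * z.2)%R =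
   \int[normal_prob 0 1 \x normal_prob 0 1]_z f z)%E.
Proof.
have half (c' s' : R) (g : MR * MR -> \bar R) :
    c' ^+ 2 + s' ^+ 2 = 1 -> c' != -1 ->
    measurable_fun [set: MR * MR] g -> (forall z, 0 <= g z)%E ->
    (\int[normal_prob 0 1 \x normal_prob 0 1]_z
     g (c' * z.1 + s' * z.2, - s' * z.1 + c' * z.2)%R =
     \int[normal_prob 0 1 \x normal_prob 0 1]_z g z)%E.
  move=> cs1 cN1 mg g0.
  have mgr := measurableT_comp mg (measurable_linear2_pair c' s' (- s') c').
  pose G (z : MR * MR) :=
    (g z * (normal_peak 1 ^+ 2 * expR (- ((z.1 ^+ 2 + z.2 ^+ 2) / 2)))%:E)%E.
  have mG : measurable_fun [set: MR * MR] G.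
    apply: emeasurable_funM => //; apply/measurable_EFinP.
    apply: measurable_funM => //; apply: measurableT_comp => //.
    apply: measurableT_comp => //; apply: measurable_funM => //.
    by apply: measurable_funD; apply: measurable_funX.
  have G0 z : (0 <= G z)%E.
    rewrite mule_ge0// lee_fin mulr_ge0 ?expR_ge0//.
    by rewrite exprn_ge0// normal_peak_ge0.
  apply: etrans (ge0_integral_standard_normal2 _ mgr (fun=> g0 _)) _.
  apply: etrans _ (esym (ge0_integral_standard_normal2 _ mg g0)).
  apply: etrans _ (ge0_integral_lebesgue_rotation _ _ _ cs1 cN1 mG G0).
  apply: eq_integral => x _; apply: eq_integral => y _.
  have s2 : s' ^+ 2 = 1 - c' ^+ 2 by rewrite -cs1 addrAC subrr add0r.
  rewrite /G/=; do 6 f_equal; ring: s2.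
move=> cs1 mf f0; have [cN1|] := eqVneq c (-1); last first.
  by move=> cN1; exact: (half c s f cs1 cN1 mf f0).
have s0 : s = 0.
  by apply/eqP; rewrite -sqrf_eq0; apply/eqP; move: cs1; rewrite cN1; lra.
(* the rotation of angle [pi] is the square of a quarter turn *)
have q : (0 : R) ^+ 2 + 1 ^+ 2 = 1 by rewrite expr0n expr1n add0r.
have q1 : (0 : R) != -1 by rewrite eq_sym oppr_eq0 oner_neq0.
apply: etrans _ (half 0 1 f q q1 mf f0).
have mfq := measurableT_comp mf (measurable_linear2_pair 0 1 (- 1) 0).
apply: etrans _ (half 0 1 _ q q1 mfq (fun=> f0 _)).
apply: eq_integral => z _ /=; rewrite cN1 s0; congr (f (_, _)); ring.
Qed.

End standard_normal.

(** * The law of a pair of linear forms *)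

Section joint_law.
Context {R : realType}.
Local Notation MR := (measurableTypeR R).
Local Notation gamma := (normal_prob (0 : R) 1).

(** The plane is rotated so that the first axis points along [(a, b)]; [(beta, delta)] are the
    coordinates of [(c, d)] in the rotated frame. *)
Lemma normal_pair_law (a b c d : R) : exists beta delta : R,
  let r := Num.sqrt (a ^+ 2 + b ^+ 2) in
  [/\ r * beta = a * c + b * d,
      beta ^+ 2 + delta ^+ 2 = c ^+ 2 + d ^+ 2 &
      forall h : MR * MR -> \bar R,
        measurable_fun [set: MR * MR] h -> (forall z, 0 <= h z)%E ->
        (\int[gamma \x gamma]_z h (a * z.1 + b * z.2, c * z.1 + d * z.2)%R =
         \int[gamma \x gamma]_z h (r * z.1, beta * z.1 + delta * z.2)%R)%E].
Proof.
set r := Num.sqrt _; have r2 : r ^+ 2 = a ^+ 2 + b ^+ 2.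
  by rewrite sqr_sqrtr// addr_ge0// sqr_ge0.
(* If [(a, b)] is zero it gives no direction to rotate to, and no rotation is necessary. *)
have [r0|r0] := eqVneq r 0.
  have /eqP : a ^+ 2 + b ^+ 2 = 0 by rewrite -r2 r0 expr0n.
  rewrite paddr_eq0 ?sqr_ge0// !sqrf_eq0 => /andP[/eqP -> /eqP ->].
  exists c, d; split=> [||h mh h0]; [by rewrite r0; ring|by []|].
  by apply: eq_integral => z _; rewrite r0 !mul0r addr0.
pose C := a / r; pose S := b / r.
have aE : r * C = a by rewrite /C mulrC divfK.
have bE : r * S = b by rewrite /S mulrC divfK.
have CS : C ^+ 2 + S ^+ 2 = 1.
  by apply: (mulfI (expf_neq0 2 r0)); rewrite mulr1 [RHS]r2 -aE -bE; ring.
have S2 : S ^+ 2 = 1 - C ^+ 2 by rewrite -CS addrAC subrr add0r.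
exists (c * C + d * S), (d * C - c * S); split=> [||h mh h0] /=.
- by rewrite -aE -bE; ring.
- ring: S2.
- rewrite -(@ge0_integral_normal_rotation R C S (fun z => h (r * z.1,
    (c * C + d * S) * z.1 + (d * C - c * S) * z.2)))//=.
    apply: eq_integral => z _; congr (h (_, _)); first by rewrite -aE -bE; ring.
    ring: S2.
  apply: measurableT_comp => //.
  have := measurable_linear2_pair r 0 (c * C + d * S) (d * C - c * S).
  by apply: eq_measurable_fun => z _ /=; rewrite mul0r addr0.
Qed.

(** This is the pair law with zero second form, applied to a function of the first coordinate
    alone. *)
Lemma normal_sum_law (a b : R) (k : MR -> \bar R) :
  measurable_fun [set: MR] k -> (forall x, 0 <= k x)%E ->
  (\int[gamma]_x \int[gamma]_y k (a * x + b * y)%R =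
   \int[gamma]_x k (Num.sqrt (a ^+ 2 + b ^+ 2) * x)%R)%E.
Proof.
move=> mk k0; have [beta [delta [_ _ law]]] := normal_pair_law a b 0 0.
have mlin (u v : R) :
    measurable_fun [set: MR * MR] (fun z : MR * MR => k (u * z.1 + v * z.2)).
  by apply: measurableT_comp => //; exact: measurable_linear2.
have mr : measurable_fun [set: MR * MR]
    (fun z : MR * MR => k (Num.sqrt (a ^+ 2 + b ^+ 2) * z.1)).
  have := mlin (Num.sqrt (a ^+ 2 + b ^+ 2)) 0.
  by apply: eq_measurable_fun => z _ /=; rewrite mul0r addr0.
apply: etrans (esym (fubini_tonelli1 _ (mlin a b) (fun=> k0 _))) _.
apply: etrans (law _ (measurableT_comp mk measurable_fst) (fun=> k0 _)) _.
apply: etrans (fubini_tonelli1 _ mr (fun=> k0 _)) _.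
apply: eq_integral => x _; rewrite /fubini_F/= integral_cst//=.
by rewrite probability_setT mule1.
Qed.

Lemma measurable_dotp n (w : Rn R n) :
  measurable_fun [set: Rn R n] (fun x : Rn R n => dotp x w : MR).
Proof.
rewrite /dotp; apply: measurable_sum => i.
by apply: measurable_funM => //; exact: measurable_tnth.
Qed.

Lemma measurable_dotp_pair n (w v : Rn R n) :
  measurable_fun [set: Rn R n]
    (fun x : Rn R n => (dotp x w, dotp x v) : MR * MR).
Proof. by apply/measurable_fun_pairP; split; exact: measurable_dotp. Qed.

Lemma dotp_consRn m (a : MR) (x : Rn R m) (w : Rn R m.+1) :
  dotp (consRn (a, x)) w =
  a * tnth w ord0 + dotp x [tuple tnth w (lift ord0 i) | i < m].
Proof.
rewrite /dotp big_ord_recl tnth0; congr (_ + _).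
by apply: eq_bigr => i _; rewrite tnthS tnth_mktuple.
Qed.

Lemma dotp_recl m (w v : Rn R m.+1) :
  dotp w v = tnth w ord0 * tnth v ord0 +
    dotp [tuple tnth w (lift ord0 i) | i < m] [tuple tnth v (lift ord0 i) | i < m].
Proof.
rewrite /dotp big_ord_recl; congr (_ + _).
by apply: eq_bigr => i _; rewrite !tnth_mktuple.
Qed.

(* [(alpha, beta, sigma)] is the Cholesky factor of the Gram matrix of [w], [v]. *)
Lemma gaussian_pair_law n (w v : Rn R n) : exists alpha beta sigma : R,
  [/\ 0 <= alpha /\ 0 <= sigma,
      alpha ^+ 2 = dotp w w,
      alpha * beta = dotp w v,
      beta ^+ 2 + sigma ^+ 2 = dotp v v &
      forall h : MR * MR -> \bar R,
        measurable_fun [set: MR * MR] h -> (forall z, 0 <= h z)%E ->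
        (\int[gaussian n]_x h (dotp x w, dotp x v) =
         \int[gamma \x gamma]_z h (alpha * z.1, beta * z.1 + sigma * z.2)%R)%E].
Proof.
elim: n w v => [|m IHm] w v.
  exists 0, 0, 0; rewrite /dotp !big_ord0.
  split; rewrite ?mulr0 ?expr0n ?addr0// => h mh h0.
  have mhd := measurableT_comp mh (measurable_dotp_pair _ w v).
  apply: etrans (integral_dirac _ _ mhd) _ => //.
  rewrite diracE mem_set// mul1e /= /dotp !big_ord0.
  under [RHS]eq_integral do rewrite !mul0r addr0.
  by rewrite integral_cst//= probability_setT mule1.
set w0 := tnth w ord0; set v0 := tnth v ord0.
set w' := [tuple tnth w (lift ord0 i) | i < m].
set v' := [tuple tnth v (lift ord0 i) | i < m].
(* By induction the later coordinates contribute [(alpha X, beta X + sigma Y)]. A rotation mixing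
   the first coordinate with [X] makes the rows [(w0, alpha)] and [(v0, beta)] triangular. The two
   independent noises left in the second form, with coefficients [delta] and [sigma], then merge
   into one by [normal_sum_law]. *)
have [alpha [beta [sigma [[alpha0 sigma0] aw aw' bv law]]]] := IHm w' v'.
have [beta' [delta [rb bd law2]]] := normal_pair_law w0 alpha v0 beta.
set r := Num.sqrt (w0 ^+ 2 + alpha ^+ 2) in rb bd law2.
exists r, beta', (Num.sqrt (delta ^+ 2 + sigma ^+ 2)); split.
- by rewrite !sqrtr_ge0.
- by rewrite sqr_sqrtr ?addr_ge0 ?sqr_ge0// dotp_recl -aw -expr2.
- by rewrite rb dotp_recl -aw'.
- rewrite sqr_sqrtr ?addr_ge0 ?sqr_ge0// dotp_recl -bv addrA bd -expr2.
  by rewrite addrA.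
move=> h mh h0.
have mpair n' (w1 v1 : Rn R n') : measurable_fun [set: Rn R n']
    (fun x : Rn R n' => h (dotp x w1, dotp x v1)).
  by apply: measurableT_comp => //; exact: measurable_dotp_pair.
apply: etrans (ge0_integral_distribution _ (mpair _ _ _) (fun=> h0 _)) _.
apply: etrans (fubini_tonelli1 _
  (measurableT_comp (mpair _ _ _) (measurable_consRn (n := m))) (fun=> h0 _)) _.
(* [H] averages over the noise [Y], so that [law2] can act on the first coordinate and [X] alone. *)
pose H (z : MR * MR) : \bar R := (\int[gamma]_y h (z.1, z.2 + sigma * y)%R)%E.
have m3 : measurable_fun [set: (MR * MR) * MR]
    (fun t : (MR * MR) * MR => h (t.1.1, t.1.2 + sigma * t.2)).
  apply: measurableT_comp => //; apply/measurable_fun_pairP; split => /=.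
    exact: measurableT_comp measurable_fst measurable_fst.
  apply: measurable_funD.
    exact: measurableT_comp measurable_snd measurable_fst.
  by apply: measurable_funM => //; exact: measurable_snd.
have mH : measurable_fun [set: MR * MR] H.
  exact: (measurable_fun_fubini_tonelli_F
            (fun t : (MR * MR) * MR => h (t.1.1, t.1.2 + sigma * t.2))).
have H0 z : (0 <= H z)%E by apply: integral_ge0.
transitivity (\int[gamma]_a \int[gamma]_x H (w0 * a + alpha * x, v0 * a + beta * x)%R)%E.
  apply: eq_integral => a _; rewrite /fubini_F/=.
  under eq_integral do rewrite !dotp_consRn.
  have msh : measurable_fun [set: MR * MR]
      (fun z : MR * MR => h (a * w0 + z.1, a * v0 + z.2)).
    apply: measurableT_comp => //; apply/measurable_fun_pairP; split => /=.
      exact: measurable_funD.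
    exact: measurable_funD.
  apply: etrans (law _ msh (fun=> h0 _)) _.
  have mlin : measurable_fun [set: MR * MR]
      (fun z : MR * MR => (alpha * z.1, beta * z.1 + sigma * z.2) : MR * MR).
    have := measurable_linear2_pair alpha 0 beta sigma.
    by apply: eq_measurable_fun => z _ /=; rewrite mul0r addr0.
  apply: etrans (fubini_tonelli1 _ (measurableT_comp msh mlin) (fun=> h0 _)) _.
  apply: eq_integral => x _; apply: eq_integral => y _ /=.
  by congr (h (_, _)); ring.
apply: etrans (esym (fubini_tonelli1 _ (measurableT_comp mH
  (measurable_linear2_pair w0 alpha v0 beta)) (fun=> H0 _))) _.
apply: etrans (law2 _ mH H0) _.
have mtri (p q u : R) : measurable_fun [set: MR * MR]
    (fun z : MR * MR => (p * z.1, q * z.1 + u * z.2) : MR * MR).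
  have := measurable_linear2_pair p 0 q u.
  by apply: eq_measurable_fun => z _ /=; rewrite mul0r addr0.
apply: etrans (fubini_tonelli1 _ (measurableT_comp mH (mtri _ _ _))
  (fun=> H0 _)) _.
apply: etrans _ (esym (fubini_tonelli1 _ (measurableT_comp mh (mtri _ _ _))
  (fun=> h0 _))).
apply: eq_integral => x _.
have mk : measurable_fun [set: MR] (fun q : MR => h (r * x, beta' * x + q)).
  apply: measurableT_comp => //; apply/measurable_fun_pairP; split.
    exact: measurable_cst.
  exact: (measurable_funD (measurable_cst _) (@measurable_id _ MR _)).
apply: etrans _ (normal_sum_law delta sigma _ mk (fun=> h0 _)).
apply: eq_integral => y _; apply: eq_integral => z _ /=.
by rewrite addrA.
Qed.

(** For a unit vector [w] the Cholesky factor has [alpha = 1], hence [beta = dotp w v]. Positive and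
    negative parts extend the law to signed [h], as the integrands of influences change sign. *)
Lemma gaussian_pair_integral n (w v : Rn R n) : dotp w w = 1 ->
  exists2 sigma : R, 0 <= sigma /\ dotp w v ^+ 2 + sigma ^+ 2 = dotp v v &
  forall h : MR * MR -> \bar R, measurable_fun [set: MR * MR] h ->
    (\int[gaussian n]_x h (dotp x w, dotp x v) =
     \int[gamma \x gamma]_z h (z.1, dotp w v * z.1 + sigma * z.2)%R)%E.
Proof.
move=> w1; have [alpha [beta [sigma [[a0 s0] aw ab bs law]]]] := gaussian_pair_law _ w v.
have a1 : alpha = 1.
  by apply/eqP; rewrite -(@eqrXn2 _ 2)// expr1n aw w1.
move: ab law; rewrite a1 mul1r => <- law; exists sigma => // h mh.
pose L (x : Rn R n) : MR * MR := (dotp x w, dotp x v).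
pose L' (z : MR * MR) : MR * MR := (z.1, beta * z.1 + sigma * z.2).
rewrite -[LHS]/(\int[gaussian n]_x (h \o L) x)%E.
rewrite -[RHS]/(\int[gamma \x gamma]_z (h \o L') z)%E.
rewrite integralE [RHS]integralE.
have hp := law _ (measurable_funepos mh) (funepos_ge0 _).
have hn := law _ (measurable_funeneg mh) (funeneg_ge0 _).
congr (_ - _)%E.
  under eq_integral do rewrite funepos_comp.
  under [RHS]eq_integral do rewrite funepos_comp.
  by apply: etrans hp _; apply: eq_integral => z _; rewrite mul1r.
under eq_integral do rewrite funeneg_comp.
under [RHS]eq_integral do rewrite funeneg_comp.
by apply: etrans hn _; apply: eq_integral => z _; rewrite mul1r.
Qed.

End joint_law.

(** * Truncated first moments of the normal law *)

Section standard_normal_mean.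
Context {R : realType}.
Local Notation mu := (@lebesgue_measure R).
Local Notation MR := (measurableTypeR R).
Local Notation gamma := (normal_prob (0 : R) 1).
Local Notation phi := (normal_pdf (0 : R) 1).

Lemma integral_normal_prob (m sigma : R) (f : MR -> \bar R) :
  measurable_fun [set: MR] f ->
  (\int[normal_prob m sigma]_x f x =
   \int[mu]_x (f x * (normal_pdf m sigma x)%:E))%E.
Proof.
move=> mf; rewrite integralE [RHS]integralE; congr (_ - _)%E.
- apply: etrans (ge0_integral_normal_prob _ _ _ (measurable_funepos mf)
    (funepos_ge0 _)) _.
  apply: eq_integral => x _; rewrite !funeposE.
  by rewrite maxe_pMl ?mul0e ?lee_fin ?normal_pdf_ge0.
- apply: etrans (ge0_integral_normal_prob _ _ _ (measurable_funeneg mf)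
    (funeneg_ge0 _)) _.
  apply: eq_integral => x _; rewrite !funenegE -muleN.
  by rewrite muleN -mulNe maxe_pMl ?mul0e ?lee_fin ?normal_pdf_ge0.
Qed.

(** This supplies the antiderivative that evaluates the truncated first moments. *)
Lemma is_derive_standard_normal_pdf (x : R) :
  is_derive x 1 (fun y => - phi y) (x * phi x).
Proof.
rewrite (_ : (fun y => - phi y) =
    (fun y => - (normal_peak 1 * expR (- (2^-1 * (y ^+ 2)))))); last first.
  by apply/funext => y; rewrite standard_normal_pdfE mulrC [in RHS]mulrC
    [2^-1 * _]mulrC.
apply: is_derive_eq.
rewrite standard_normal_pdfE [_ ^+ 2 / 2]mulrC /GRing.scale/=.
by field.
Qed.

Lemma cvg_standard_normal_pdf : - phi x @[x --> +oo] --> (0 : R).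
Proof.
suff : phi x @[x --> +oo] --> (0 : R) by move=> /cvgN; rewrite oppr0.
rewrite (_ : phi = (fun x => normal_peak 1 * expR (- (x ^+ 2 / 2)))); last first.
  by apply/funext => x; rewrite standard_normal_pdfE.
rewrite -[X in _ --> X](mulr0 (normal_peak 1)); apply: cvgMl_tmp.
apply: (cvg_comp (fun x : R => x ^+ 2 / 2) (fun x => expR (- x))); last first.
  exact: cvgr_expR.
by apply: gt0_cvgMly; [rewrite invr_gt0|exact: cvgr_expr2].
Qed.

Lemma continuous_mul_standard_normal_pdf : continuous (fun x : R => x * phi x).
Proof.
by move=> x; apply: cvgM; [exact: cvg_id|exact/continuous_normal_pdf/oner_neq0].
Qed.

Lemma integral_tail_mul_standard_normal_pdf (t : R) : 0 <= t ->
  (\int[mu]_(x in `[t, +oo[) (x * phi x)%:E = (phi t)%:E)%E.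
Proof.
move=> t0; rewrite (@ge0_continuous_FTC2y R _ (fun x => - phi x) t 0).
- by rewrite -EFinB sub0r opprK.
- by move=> x tx; rewrite mulr_ge0 ?normal_pdf_ge0// (le_trans t0).
- exact/continuous_subspaceT/continuous_mul_standard_normal_pdf.
- exact: cvg_standard_normal_pdf.
- by move=> x _; apply: ex_derive; exact: is_derive_standard_normal_pdf.
- apply: cvg_at_right_filter; apply: cvgN.
  exact/continuous_normal_pdf/oner_neq0.
- move=> x _; rewrite derive1E.
  exact: (@derive_val _ _ _ _ _ _ _ (is_derive_standard_normal_pdf x)).
Qed.

(** Reflection is the case of coefficients [- 1] and [0] in [normal_sum_law]. *)
Lemma normal_prob_symmetric (k : MR -> \bar R) :
  measurable_fun [set: MR] k -> (forall x, 0 <= k x)%E ->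
  (\int[gamma]_x k (- x)%R = \int[gamma]_x k x)%E.
Proof.
move=> mk k0; have := normal_sum_law (- 1) 0 k mk k0.
rewrite expr0n addr0 sqrrN expr1n sqrtr1.
under [RHS]eq_integral do rewrite mul1r.
move=> <-; apply: eq_integral => x _.
under [RHS]eq_integral do rewrite mul0r addr0 mulN1r.
by rewrite integral_cst//= probability_setT mule1.
Qed.

Lemma integral_normal_prob_pos_part :
  (\int[gamma]_x (Num.max x 0)%:E = (phi 0)%:E)%E.
Proof.
rewrite integral_normal_prob; last first.
  by apply/measurable_EFinP; exact: measurable_maxr.
rewrite -(integral_tail_mul_standard_normal_pdf 0 (lexx _)).
rewrite [RHS]integral_mkcond; apply: eq_integral => x _.
rewrite patchE mem_setE in_itv/= andbT -EFinM.
by case: (leP 0 x) => x0 //; rewrite mul0r.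
Qed.

Lemma integrable_normal_prob_id : gamma.-integrable setT (fun x : MR => x%:E).
Proof.
apply/integrableP; split; first exact/measurable_EFinP.
have mpos : measurable_fun [set: MR] (fun x : MR => (Num.max x 0)%:E).
  by apply/measurable_EFinP; exact: measurable_maxr.
have mneg : measurable_fun [set: MR] (fun x : MR => (Num.max (- x) 0)%:E).
  by apply/measurable_EFinP; apply: measurable_maxr => //; exact: measurable_funN.
under eq_integral => x _.
  rewrite abse_EFin (_ : `|x| = Num.max x 0 + Num.max (- x) 0)%R ?EFinD; last first.
    by case: (ger0P x) => x0; rewrite !maxEle; do ?case: ifP => ?; lra.
  over.
rewrite ge0_integralD//=; last 2 first.
- by move=> x _; rewrite lee_fin le_max lexx orbT.
- by move=> x _; rewrite lee_fin le_max lexx orbT.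
rewrite (normal_prob_symmetric (fun x => (Num.max x 0)%:E))//; last first.
  by move=> x; rewrite lee_fin le_max lexx orbT.
by rewrite integral_normal_prob_pos_part -EFinD ltry.
Qed.

Lemma integral_normal_prob_id : (\int[gamma]_x x%:E = 0)%E.
Proof.
have mpos : measurable_fun [set: MR] (fun x : MR => (Num.max x 0)%:E).
  by apply/measurable_EFinP; exact: measurable_maxr.
rewrite integralE.
under eq_integral do rewrite funeposE -EFin_max.
under [X in (_ - X)%E]eq_integral do rewrite funenegE -EFinN -EFin_max.
rewrite (normal_prob_symmetric (fun x => (Num.max x 0)%:E))//; last first.
  by move=> x; rewrite lee_fin le_max lexx orbT.
by rewrite integral_normal_prob_pos_part subee.
Qed.

Lemma integral_normal_prob_tail (t : R) :
  (\int[gamma]_x (\1_`]t, +oo[ x * x)%:E = (phi t)%:E)%E.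
Proof.
have mtail : measurable_fun [set: R] (fun x : R => \1_`]t, +oo[%classic x * x).
  by apply: measurable_funM => //; exact: measurable_indic.
rewrite integral_normal_prob; last exact/measurable_EFinP.
pose f (x : R) := (x * phi x)%:E.
have mf D : measurable_fun D f.
  apply/measurable_funTS/measurable_EFinP.
  by apply: measurable_funM => //; exact: measurable_normal_pdf.
transitivity (\int[mu]_(x in `]t, +oo[) f x)%E.
  rewrite [RHS]integral_mkcond; apply: eq_integral => x _.
  rewrite patchE indicE mem_setE -EFinM; case: ifP => _; first by rewrite mul1r.
  by rewrite !mul0r.
(* The half-line formula is for a nonnegative integrand. A ray with negative [t] is cut at [0], and
   the piece []t, 0]] contributes [phi t - phi 0]. *)
have [t0|t0] := leP 0 t.
  by rewrite integral_itv_obnd_cbnd// integral_tail_mul_standard_normal_pdf.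
transitivity (\int[mu]_(x in `]t, 0%R]) f x + \int[mu]_(x in `]0%R, +oo[) f x)%E.
  rewrite (@itv_bndbnd_setU _ _ _ (BRight 0))//; last by rewrite bnd_simp ltW.
  apply: integral_setU => //; first exact: mf.
  by apply/disj_setPS => x [] /=; rewrite !in_itv/= => /andP[_ ?]; lra.
rewrite !integral_itv_obnd_cbnd// integral_tail_mul_standard_normal_pdf//.
rewrite (@continuous_FTC2 R _ (fun x => - phi x))//.
- by rewrite -EFinB -EFinD; congr (_%:E); ring.
- exact/continuous_subspaceT/continuous_mul_standard_normal_pdf.
- split.
  + by move=> x _; apply: ex_derive; exact: is_derive_standard_normal_pdf.
  + apply: cvg_at_right_filter; apply: cvgN.
    exact/continuous_normal_pdf/oner_neq0.
  + apply: cvg_at_left_filter; apply: cvgN.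
    exact/continuous_normal_pdf/oner_neq0.
- move=> x _; rewrite derive1E.
  exact: (@derive_val _ _ _ _ _ _ _ (is_derive_standard_normal_pdf x)).
Qed.

End standard_normal_mean.

(** * Influences of threshold sets *)

Section threshold_influence.
Context {R : realType}.
Local Notation MR := (measurableTypeR R).
Local Notation gamma := (normal_prob (0 : R) 1).
Local Notation phi := (normal_pdf (0 : R) 1).

Lemma integral_normal_prob_affine (c0 c1 : R) :
  (\int[gamma]_y (c0 + c1 * y)%:E = c0%:E)%E.
Proof.
have iid := @integrable_normal_prob_id R.
under eq_integral do rewrite EFinD EFinM.
have icst : gamma.-integrable setT (fun _ : MR => c0%:E).
  exact: finite_measure_integrable_cst.
have iZ : gamma.-integrable setT (fun y : MR => (c1%:E * y%:E)%E).
  exact: integrableZl.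
apply: etrans (integralD _ icst iZ) _ => //.
rewrite integralZl// integral_normal_prob_id mule0 adde0 integral_cst//=.
by rewrite probability_setT mule1.
Qed.

Lemma integrable_normal_prob2_linear (a b : R) :
  (gamma \x gamma)%E.-integrable setT
    (fun z : MR * MR => (a * z.1 + b * z.2)%:E).
Proof.
have fin := @integrable_normal_prob_id R.
have i1 : (gamma \x gamma)%E.-integrable setT (fun z : MR * MR => z.1%:E).
  apply/integrable12ltyP; first by apply/measurable_EFinP; exact: measurable_fst.
  under eq_integral.
    move=> x _; rewrite /= integral_cst//= probability_setT mule1; over.
  by have /integrableP[] := fin.
have i2 : (gamma \x gamma)%E.-integrable setT (fun z : MR * MR => z.2%:E).
  apply/integrable12ltyP; first by apply/measurable_EFinP; exact: measurable_snd.
  apply: le_lt_trans (_ : \int[gamma]_y `|y%:E| < +oo)%E; last first.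
    by have /integrableP[] := fin.
  rewrite -[X in (_ <= X)%E]mule1 -(@probability_setT _ _ R gamma).
  by rewrite -integral_cst.
have -> : (fun z : MR * MR => (a * z.1 + b * z.2)%:E) =
    (fun z : MR * MR => a%:E * z.1%:E + b%:E * z.2%:E)%E.
  by apply/funext => z; rewrite EFinD !EFinM.
by apply: integrableD => //; exact: integrableZl.
Qed.

(** The integrand is dominated by an integrable linear form, so Fubini applies: the inner integral
    removes the centred term [b * z.2], and [a] times the truncated first moment remains. *)
Lemma integral_normal_prob2_tail (t a b : R) :
  (\int[gamma \x gamma]_z (\1_(`]t, +oo[) z.1 * (a * z.1 + b * z.2))%:E =
   (a * phi t)%:E)%E.
Proof.
pose f (z : MR * MR) := (\1_(`]t, +oo[) z.1 * (a * z.1 + b * z.2))%:E.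
have mI : measurable_fun [set: R] (fun x : R => \1_(`]t, +oo[%classic) x : R).
  exact: measurable_indic.
have mf : measurable_fun [set: MR * MR] f.
  apply/measurable_EFinP; apply: measurable_funM.
    exact: (measurableT_comp mI measurable_fst).
  exact: measurable_linear2.
have if_ : (gamma \x gamma)%E.-integrable setT f.
  apply: le_integrable (integrable_normal_prob2_linear a b) => // z _.
  rewrite /f /= lee_fin normrM indicE.
  by case: (_ \in _); rewrite ?normr1 ?mul1r// normr0 mul0r.
apply: etrans (esym (integral12_prod_meas1 if_)) _.
transitivity (\int[gamma]_x (a%:E * (\1_(`]t, +oo[) x * x)%:E))%E.
  apply: eq_integral => x _; rewrite /fubini_F/=.
  transitivity (\int[gamma]_y
      (\1_(`]t, +oo[) x * (a * x) + \1_(`]t, +oo[) x * b * y)%:E)%E.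
    by apply: eq_integral => y _; rewrite /f/= mulrDr !mulrA.
  by rewrite integral_normal_prob_affine -EFinM mulrCA.
rewrite integralZl// ?integral_normal_prob_tail//.
apply: le_integrable (@integrable_normal_prob_id R) => //.
  by apply/measurable_EFinP; apply: measurable_funM.
move=> x _; rewrite lee_fin normrM indicE.
by case: (_ \in _); rewrite ?normr1 ?mul1r// normr0 mul0r.
Qed.

Lemma threshold_setE n (w : Rn R n) (t : R) :
  threshold_set w t = (fun x => dotp x w) @^-1` `]t, +oo[.
Proof. by apply/seteqP; split=> x /=; rewrite in_itv/= andbT. Qed.

Lemma measurable_threshold_set n (w : Rn R n) (t : R) :
  measurable (threshold_set w t).
Proof.
rewrite threshold_setE -[X in measurable X]setTI.
by apply: measurable_dotp => //.
Qed.

(** The [k]-th coordinate is itself the linear form of a basis vector [e], so the law of a pair of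
    forms applies to [w] and [e], with [dotp w e = tnth w k]. *)
Lemma influence_threshold_set n (w : Rn R n) (t : R) (k : 'I_n) :
  dotp w w = 1 -> influence k (threshold_set w t) = tnth w k * phi t.
Proof.
move=> w1; pose e : Rn R n := [tuple (i == k)%:R | i < n].
have dotpe x : dotp x e = tnth x k.
  rewrite /dotp (bigD1 k)//= tnth_mktuple eqxx mulr1 big1 ?addr0// => i ik.
  by rewrite tnth_mktuple (negbTE ik) mulr0.
have [sigma _ law] := gaussian_pair_integral _ w e w1.
pose h (p : MR * MR) := (\1_(`]t, +oo[) p.1 * p.2)%:E.
have mh : measurable_fun [set: MR * MR] h.
  apply/measurable_EFinP; apply: measurable_funM => //.
  have mI : measurable_fun [set: R] (fun x : R => \1_(`]t, +oo[%classic) x : R).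
    exact: measurable_indic.
  exact: (measurableT_comp mI measurable_fst).
rewrite /influence unlock.
have -> : (\int[gaussian n]_x (\1_(threshold_set w t) x * tnth x k)%:E =
    \int[gaussian n]_x h (dotp x w, dotp x e))%E.
  apply: eq_integral => x _; rewrite /h/= dotpe threshold_setE.
  by rewrite !indicE !mem_setE.
by rewrite (law _ mh) /h/= integral_normal_prob2_tail dotpe.
Qed.

Lemma W1_threshold_set n (w v : Rn R n) (t s : R) :
  dotp w w = 1 -> dotp v v = 1 ->
  W1 (threshold_set w t) (threshold_set v s) = dotp w v * (phi t * phi s).
Proof.
move=> w1 v1; rewrite /W1 /dotp big_distrl/=; apply: eq_bigr => k _.
by rewrite !influence_threshold_set//; ring.
Qed.

Lemma norm2_dotp n (w : Rn R n) : norm2 w = 1 -> dotp w w = 1.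
Proof.
rewrite /norm2 /dotp => w1.
have w0 : 0 <= \sum_(i < n) tnth w i ^+ 2.
  by apply: sumr_ge0 => i _; exact: sqr_ge0.
have := sqr_sqrtr w0; rewrite w1 expr1n => ->.
by apply: eq_bigr => i _; rewrite expr2.
Qed.

End threshold_influence.

(** * Normal density and tail bounds *)

Section standard_normal_bounds.
Context {R : realType}.
Local Notation mu := (@lebesgue_measure R).
Local Notation MR := (measurableTypeR R).
Local Notation gamma := (normal_prob (0 : R) 1).
Local Notation phi := (normal_pdf (0 : R) 1).

Lemma standard_normal_pdf_gt0 (x : R) : 0 < phi x.
Proof.
by rewrite standard_normal_pdfE mulr_gt0 ?expR_gt0// normal_peak_gt0 ?oner_neq0.
Qed.

Lemma standard_normal_pdfN (x : R) : phi (- x) = phi x.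
Proof. by rewrite !standard_normal_pdfE sqrrN. Qed.

Lemma standard_normal_pdf_ratio (x y a : R) :
  y ^+ 2 <= x ^+ 2 + 2 * a -> expR (- a) * phi x <= phi y.
Proof.
move=> xy; rewrite !standard_normal_pdfE mulrCA -expRD ler_pM2l; last first.
  by rewrite normal_peak_gt0 ?oner_neq0.
by rewrite ler_expR; lra.
Qed.

(** Within [m^-1] of [u], the exponent [z ^+ 2 / 2] exceeds [u ^+ 2 / 2] by
    [u * (z - u) + (z - u) ^+ 2 / 2], which is at most [1 + 1 / 2]. *)
Lemma standard_normal_pdf_near (u z m : R) :
  1 <= m -> `|u| <= m -> `|z - u| <= m^-1 -> expR (- (3 / 2)) * phi u <= phi z.
Proof.
move=> m1 um zu; apply: standard_normal_pdf_ratio.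
have m0 : 0 < m by apply: lt_le_trans m1.
have iv1 : m^-1 <= 1 by rewrite invf_le1.
have uz : `|u| * `|z - u| <= 1.
  apply: (@le_trans _ _ (m * m^-1)); last by rewrite divff// gt_eqF.
  by apply: ler_pM.
have uz' : u * (z - u) <= 1 by apply: le_trans uz; rewrite -normrM ler_norm.
have zu2 : (z - u) ^+ 2 <= 1.
  by rewrite -real_normK ?num_real// expr_le1//; apply: le_trans iv1.
have -> : z ^+ 2 = u ^+ 2 + 2 * (u * (z - u)) + (z - u) ^+ 2 by ring.
lra.
Qed.

Lemma normal_prob_itv_ge (a b K : R) (b0 b1 : bool) : a <= b ->
  (forall x, a <= x <= b -> K <= phi x) -> 0 <= K ->
  (((b - a) * K)%:E <= gamma [set` Interval (BSide b0 a) (BSide b1 b)])%E.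
Proof.
move=> ab hK K0; set I := [set` _].
have mI : measurable (I : set MR) by exact: measurable_itv.
apply: (@le_trans _ _ (\int[mu]_(x in I) K%:E)%E).
  rewrite integral_cst//= lebesgue_measure_itv/= lte_fin.
  case: ltP => [_|ba]; first by rewrite -EFinB -EFinM mulrC.
  by rewrite mule0 lee_fin (@le_anti _ _ a b) ?ab// subrr mul0r.
apply: ge0_le_integral => //=.
- by apply/measurable_funTS/measurable_EFinP; exact: measurable_normal_pdf.
- move=> x Ix; rewrite lee_fin hK//.
  by move: Ix; rewrite /I/= in_itv/= => /andP[/lteifW -> /lteifW ->].
Qed.

Lemma normal_prob_itv_near (u m a b : R) (b0 b1 : bool) :
  1 <= m -> `|u| <= m -> a <= b -> u - m^-1 <= a -> b <= u + m^-1 ->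
  (((b - a) * (expR (- (3 / 2)) * phi u))%:E <=
    gamma [set` Interval (BSide b0 a) (BSide b1 b)])%E.
Proof.
move=> m1 um ab au bu; apply: normal_prob_itv_ge => //.
  move=> x /andP[ax xb]; apply: standard_normal_pdf_near m1 um _.
  by rewrite ler_norml; apply/andP; split; lra.
by rewrite mulr_ge0 ?expR_ge0// ltW ?standard_normal_pdf_gt0.
Qed.

(** An interval of length [T^-1] next to [T] or [- T] already carries this mass, since the density
    stays comparable to [phi T] on it. *)
Lemma normal_prob_tail_ge (T : R) : 1 <= T ->
  ((T^-1 * (expR (- (3 / 2)) * phi T))%:E <= gamma `]T, +oo[)%E /\
  ((T^-1 * (expR (- (3 / 2)) * phi T))%:E <= gamma `]-oo, (- T)%R[)%E.
Proof.
move=> T1; have T0 : 0 < T by apply: lt_le_trans T1.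
have i0 : 0 <= T^-1 by rewrite invr_ge0 ltW.
have aT : `|T| <= T by rewrite ger0_norm// ltW.
have aNT : `|- T| <= T by rewrite normrN.
split.
  apply: (@le_trans _ _ (gamma `]T, (T + T^-1)%R])).
    have := @normal_prob_itv_near T T T (T + T^-1) false false T1 aT.
    rewrite [T + _ - _]addrAC subrr add0r; apply => //; lra.
  rewrite le_measure ?inE//; exact: subset_itvl.
apply: (@le_trans _ _ (gamma `](- T - T^-1)%R, (- T)%R[)).
  have := @normal_prob_itv_near (- T) T (- T - T^-1) (- T) false true T1 aNT.
  rewrite standard_normal_pdfN (_ : - T - (- T - T^-1) = T^-1); last by ring.
  by apply => //; lra.
rewrite le_measure ?inE//; exact: subset_itvr.
Qed.

(** As [normal_peak 1 <= 1], the square of [phi t] is at most [expR (- t ^+ 2)], so the logarithm is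
    at least [1 + t ^+ 2], which dominates both [1] and [t ^+ 2]. The factor [1] in the statement
    stands for [dotp w w]. *)
Lemma le_sqrt_ln_standard_normal_pdf (t : R) :
  Num.max 1 `|t| <= Num.sqrt (ln (expR 1 / (1 * (phi t * phi t)))).
Proof.
have phi0 := standard_normal_pdf_gt0 t.
have peak1 : normal_peak 1 <= 1 :> R.
  rewrite /normal_peak invf_le1 ?sqrtr_gt0; last first.
    by rewrite expr1n mul1r mulrn_wgt0// pi_gt0.
  rewrite -[X in X <= _]sqrtr1 ler_wsqrtr// expr1n mul1r.
  by have := pi_ge2 R; lra.
have phile : phi t * phi t <= expR (- t ^+ 2).
  rewrite standard_normal_pdfE mulrACA -expRD -[leRHS]mul1r.
  rewrite ler_pM ?mulr_ge0 ?expR_ge0 ?normal_peak_ge0//.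
    by rewrite mulr_ile1 ?normal_peak_ge0.
  by rewrite ler_expR; lra.
have ge : 1 + t ^+ 2 <= ln (expR 1 / (1 * (phi t * phi t))).
  rewrite mul1r ln_div ?posrE ?expR_gt0 ?mulr_gt0// expRK lerD2l.
  by rewrite lerNr -ler_expR lnK// posrE mulr_gt0.
apply: le_trans (ler_wsqrtr ge); rewrite ge_max; apply/andP; split.
  by rewrite -[X in X <= _]sqrtr1 ler_wsqrtr// lerDl sqr_ge0.
by rewrite -sqrtr_sqr ler_wsqrtr// lerDr.
Qed.

End standard_normal_bounds.

(** * Lower bound on the covariance *)

Section monotone_tail.
Context {R : realType}.
Local Notation MR := (measurableTypeR R).
Local Notation gamma := (normal_prob (0 : R) 1).
Local Notation phi := (normal_pdf (0 : R) 1).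

Lemma integral_tail_monotone_ge (P : probability MR R) (G : MR -> \bar R)
    (p d tau t T : R) :
  measurable_fun [set: MR] G -> (forall x, 0 <= G x)%E ->
  (forall x y : R, x <= y -> (G x <= G y)%E) ->
  (\int[P]_x G x = p%:E)%E ->
  0 <= p -> 0 <= d -> 0 <= tau -> `|t| <= T ->
  (forall x : R, T < x -> ((p + d)%:E <= G x)%E) ->
  (forall x : R, x < - T -> (G x + d%:E <= p%:E)%E) ->
  (tau%:E <= P `]T, +oo[%classic)%E -> (tau%:E <= P `]-oo, (- T)%R[%classic)%E ->
  (p%:E * P `]t, +oo[%classic + (d * tau)%:E <= \int[P]_(x in `]t, +oo[) G x)%E.
Proof.
move=> mG G0 nG iG p0 d0 tau0; rewrite ler_norml => /andP[tT1 tT2] hG hG' tauT tauNT.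
have mGS (D : set MR) : measurable_fun D G by exact: measurable_funTS.
have mind (A : set MR) (c : R) : measurable A ->
    measurable_fun [set: MR] (fun x : MR => (c * \1_A x)%:E).
  by move=> mA; apply/measurable_EFinP; apply: measurable_funM.
have idind (A D : set MR) : measurable A -> measurable D -> A `<=` D ->
    (\int[P]_(x in D) (d * \1_A x)%:E = d%:E * P A)%E.
  move=> mA mD AD; under eq_integral do rewrite EFinM.
  rewrite ge0_integralZl//=; last first.
    by apply/measurable_EFinP; exact: measurable_indic.
  by rewrite integral_indic// setIidl.
(* In the first case [G] is at least [p] on the whole ray beyond [t], and the gain [d] is collected
   beyond [T]. *)
have [Gt|Gt] := leP p%:E (G t).
  apply: (@le_trans _ _ (\int[P]_(x in `]t, +oo[) (p%:E + (d * \1_`]T, +oo[%classic x)%:E))%E).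
    rewrite ge0_integralD//; last 2 first.
    - by move=> x _; rewrite lee_fin mulr_ge0.
    - by apply: measurable_funTS; exact: mind.
    rewrite integral_cst// idind//; last first.
      by move=> x /=; rewrite !in_itv/= !andbT; exact: le_lt_trans.
    by rewrite leeD2l// EFinM lee_wpmul2l// lee_fin.
  apply: ge0_le_integral => //.
  - by move=> x _; rewrite adde_ge0// lee_fin// mulr_ge0.
  - by apply: emeasurable_funD => //; apply: measurable_funTS; exact: mind.
  - move=> x /=; rewrite in_itv/= andbT => tx.
    rewrite indicE mem_setE in_itv/= andbT; case: ltP => Tx.
      by rewrite mulr1 -EFinD hG.
    by rewrite mulr0 adde0; apply: le_trans Gt _; apply: nG; exact: ltW.
(* In the second case [G] is below [p] up to [t], and the loss [d] is collected below [- T]. Since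
   [G] has mean [p] and [P] has mass 1, this deficit equals the excess on the other side. *)
have upper : (\int[P]_(x in `]-oo, t]) G x + d%:E * P `]-oo, (- T)%R[%classic <=
    p%:E * P `]-oo, t]%classic)%E.
  rewrite -[X in (_ + X)%E](idind _ `]-oo, t]%classic)//; last first.
    by move=> x /=; rewrite !in_itv/= => xT; apply: ltW; apply: lt_le_trans xT _.
  rewrite -[leRHS]integral_cst// -ge0_integralD//; last 2 first.
  - by move=> x _; rewrite lee_fin mulr_ge0.
  - by apply: measurable_funTS; exact: mind.
  apply: ge0_le_integral => //.
  - by move=> x _; rewrite adde_ge0// lee_fin// mulr_ge0.
  - by apply: emeasurable_funD => //; apply: measurable_funTS; exact: mind.
  - move=> x /=; rewrite in_itv/= => xt.
    rewrite indicE mem_setE in_itv/=; case: ltP => Tx.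
      by rewrite mulr1 hG'.
    by rewrite mulr0 adde0; apply: le_trans (ltW Gt); exact: nG.
have split_G : (\int[P]_(x in `]t, +oo[) G x + \int[P]_(x in `]-oo, t]) G x = p%:E)%E.
  rewrite -iG -(setUv `]t, +oo[%classic) setCitvr ge0_integral_setU//.
  by apply/disj_setPS => x [] /=; rewrite !in_itv/= andbT ltNge => /negP.
have split_P : (P `]t, +oo[%classic + P `]-oo, t]%classic = 1)%E.
  rewrite -(@probability_setT _ _ R P) -(setUv `]t, +oo[%classic) setCitvr measureU//.
  by apply/seteqP; split=> x //= -[]; rewrite !in_itv/= andbT ltNge => /negP.
have Ppos := integral_ge0 P (fun x (_ : `]t, +oo[%classic x) => G0 x).
have Pneg := integral_ge0 P (fun x (_ : `]-oo, t]%classic x) => G0 x).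
(* Both integrals of [G] are nonnegative with finite sum [p], hence finite; the rest is linear
   arithmetic over [R]. *)
move: Ppos Pneg upper split_G split_P tauNT.
case: (\int[P]_(x in `]t, +oo[) G x)%E => [a| |] //;
  case: (\int[P]_(x in `]-oo, t]) G x)%E => [b| |] // _ _.
rewrite -(fineK (fin_num_measure P `]t, +oo[%classic _))//.
rewrite -(fineK (fin_num_measure P `]-oo, t]%classic _))//.
rewrite -(fineK (fin_num_measure P `]-oo, (- T)%R[%classic _))//.
rewrite -!EFinM -!EFinD !lee_fin => u1 [ab] [qr] tu.
have : d * tau <= d * fine (P `]-oo, (- T)%R[%classic) by rewrite ler_wpM2l.
move: u1; rewrite (_ : fine (P `]-oo, t]%classic) =
  1 - fine (P `]t, +oo[%classic)); last by rewrite -qr addrAC subrr add0r.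
by lra.
Qed.

End monotone_tail.

(** * Conditional probability of the second threshold event given the first form *)

Section threshold_sections.
Context {R : realType}.
Local Notation MR := (measurableTypeR R).
Local Notation gamma := (normal_prob (0 : R) 1).
Local Notation phi := (normal_pdf (0 : R) 1).
Local Notation ind s := (\1_(`]s, +oo[%classic) : R -> R).

Lemma measurable_ind_ray (s : R) : measurable_fun [set: R] (ind s).
Proof. exact: measurable_indic. Qed.

Lemma ind_rayE (s x : R) : ind s x = (s < x)%R%:R.
Proof. by rewrite indicE mem_setE in_itv/= andbT. Qed.

Lemma ind_ray_ge0 (s x : R) : (0 <= (ind s x)%:E)%E.
Proof. by rewrite lee_fin. Qed.

Lemma le_ind_ray (s s' x y : R) : (s < x -> s' < y) -> ind s x <= ind s' y.
Proof. by rewrite !ind_rayE; case: ltP => [sx ->|_ _]; rewrite ?ler_nat. Qed.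

(* [threshold_section rho sigma s x = P(rho x + sigma Z > s)] *)
Definition threshold_section (rho sigma s : R) : MR -> \bar R :=
  fubini_F gamma (fun z : MR * MR => (ind s (rho * z.1 + sigma * z.2))%:E).

Lemma measurable_ind_linear2 (rho sigma s : R) : measurable_fun [set: MR * MR]
  (fun z : MR * MR => (ind s (rho * z.1 + sigma * z.2))%:E).
Proof.
apply/measurable_EFinP.
exact: (measurableT_comp (measurable_ind_ray s) (measurable_linear2 rho sigma)).
Qed.

Lemma measurable_threshold_section (rho sigma s : R) :
  measurable_fun [set: MR] (threshold_section rho sigma s).
Proof.
apply: measurable_fun_fubini_tonelli_F; first exact: measurable_ind_linear2.
by move=> z; rewrite lee_fin.
Qed.

Lemma threshold_section_ge0 (rho sigma s x : R) :
  (0 <= threshold_section rho sigma s x)%E.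
Proof. by apply: integral_ge0 => y _; rewrite lee_fin. Qed.

Lemma measurable_ind_affine (a b s : R) :
  measurable_fun [set: MR] (fun y : MR => (ind s (a + b * y))%:E).
Proof.
apply/measurable_EFinP; apply: (measurableT_comp (measurable_ind_ray s)).
by apply: measurable_funD => //; apply: measurable_funM.
Qed.

Lemma le_threshold_section (rho sigma s x y : R) : 0 <= rho -> x <= y ->
  (threshold_section rho sigma s x <= threshold_section rho sigma s y)%E.
Proof.
move=> rho0 xy; apply: ge0_le_integral => //.
- exact: (measurable_ind_affine (rho * x) sigma s).
- exact: (measurable_ind_affine (rho * y) sigma s).
- move=> z _; rewrite lee_fin; apply: le_ind_ray => /lt_le_trans; apply.
  by rewrite lerD2r ler_wpM2l.
Qed.

(** The variable [rho X + sigma Z] is again standard normal. *)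
Lemma integral_threshold_section (rho sigma s : R) :
  rho ^+ 2 + sigma ^+ 2 = 1 ->
  (\int[gamma]_x threshold_section rho sigma s x = gamma `]s, +oo[%classic)%E.
Proof.
move=> rs; have mk : measurable_fun [set: MR] (fun x : MR => (ind s x)%:E).
  by apply/measurable_EFinP; exact: measurable_ind_ray.
apply: etrans (normal_sum_law rho sigma _ mk (ind_ray_ge0 s)) _.
rewrite rs sqrtr1; under eq_integral do rewrite mul1r.
by rewrite integral_indic ?setIT.
Qed.

(** At the corner [x = T], [z = s - rho / 2] the slack is [(T - s) * (1 - sigma) + T * (rho + sigma
    - 1) - rho * sigma / 2]. The first term is nonnegative, and the second outweighs the third
    because [1 <= T] and [rho * sigma / 2 <= rho + sigma - 1]. *)
Lemma le_threshold_line (rho sigma s T x z : R) :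
  0 <= rho -> 0 <= sigma -> rho ^+ 2 + sigma ^+ 2 = 1 ->
  1 <= T -> s <= T -> T <= x -> s - rho / 2 <= z -> s <= rho * x + sigma * z.
Proof.
move=> rho0 sigma0 rs T1 sT Tx sz.
have rs0 : 0 <= rho * sigma by rewrite mulr_ge0.
have sq : (rho + sigma) ^+ 2 = 1 + 2 * (rho * sigma).
  by rewrite sqrrD addrAC rs -mulr_natl.
have rs1 : 1 <= rho + sigma.
  by rewrite -(@ler_pXn2r _ 2) ?nnegrE ?addr_ge0// expr1n sq; lra.
(* The product of [rho + sigma - 1] and [rho + sigma + 1] is [2 * (rho * sigma)], and the second
   factor is at most 3. *)
have rs2 : rho * sigma / 2 <= rho + sigma - 1.
  have : (rho + sigma - 1) * (rho + sigma + 1) = 2 * (rho * sigma).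
    by rewrite -subr_sqr expr1n sq; ring.
  have : rho + sigma <= 2.
    by have := sqr_ge0 (rho - 1); have := sqr_ge0 (sigma - 1); nra.
  nra.
have weak : s <= rho * T + sigma * (s - rho / 2).
  have sigma1 : sigma <= 1 by have := sqr_ge0 rho; nra.
  have : s * (1 - sigma) <= T * (1 - sigma) by rewrite ler_wpM2r ?subr_ge0.
  have : 1 * (rho + sigma - 1) <= T * (rho + sigma - 1).
    by rewrite ler_wpM2r// subr_ge0.
  nra.
by apply: le_trans weak _; apply: lerD; exact: ler_wpM2l.
Qed.

Lemma lt_threshold_line (rho sigma s T x z : R) :
  0 <= rho -> 0 <= sigma -> rho ^+ 2 + sigma ^+ 2 = 1 ->
  1 <= T -> s <= T -> T < x -> s - rho / 2 < z -> s < rho * x + sigma * z.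
Proof.
move=> rho0 sigma0 rs T1 sT Tx sz.
have weak := le_threshold_line _ _ _ _ _ _ rho0 sigma0 rs T1 sT (lexx T) (lexx _).
apply: le_lt_trans weak _.
(* For [rho = 0] the strict inequality comes from [z], with [sigma = 1]; otherwise it comes from
   [T < x]. *)
have [r0|r0] := eqVneq rho 0.
  have s1 : sigma = 1.
    by apply/eqP; rewrite -(@eqrXn2 _ 2)// expr1n -rs r0 expr0n add0r.
  by rewrite r0 s1; move: sz; rewrite r0; lra.
apply: ltr_leD; first by rewrite ltr_pM2l// lt_neqAle eq_sym r0.
by rewrite ler_wpM2l// ltW.
Qed.

(** Beyond [T] every [z > s - delta] belongs to the section, which therefore contains the strip []s
    - delta, s]] in addition to the ray beyond [s]. *)
Lemma threshold_section_ge (rho sigma s T delta d x : R) :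
  0 <= rho -> 0 <= sigma -> rho ^+ 2 + sigma ^+ 2 = 1 ->
  1 <= T -> s <= T -> 0 <= delta <= rho / 2 -> T < x ->
  (d%:E <= gamma `](s - delta)%R, s]%classic)%E ->
  (gamma `]s, +oo[%classic + d%:E <= threshold_section rho sigma s x)%E.
Proof.
move=> rho0 sigma0 rs T1 sT /andP[d0 dr] Tx dg.
apply: (@le_trans _ _ (gamma `](s - delta)%R, +oo[%classic)).
  rewrite [X in (_ <= gamma X)%E](@itv_bndbnd_setU _ _ _ (BRight s))//; last first.
    by rewrite bnd_simp; lra.
  rewrite measureU//; first by rewrite addeC leeD2r.
  by apply/seteqP; split=> y //= -[]; rewrite !in_itv/= andbT => /andP[_ ys] sy; lra.
rewrite -[X in gamma X]setIT -integral_indic//.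
apply: ge0_le_integral => //.
- by apply/measurable_EFinP; exact: measurable_ind_ray.
- exact: (measurable_ind_affine (rho * x) sigma s).
- move=> z _; rewrite lee_fin; apply: le_ind_ray => sz.
  apply: (lt_threshold_line _ _ _ T) => //; apply: le_lt_trans sz.
  by rewrite lerD2l lerN2.
Qed.

(** This mirrors the previous bound under a change of sign of [x], [z] and [s]: below [- T] the
    section misses the strip []s, s + delta]]. The complement of a strict event is a weak
    inequality, hence the use of [le_threshold_line]. *)
Lemma threshold_section_le (rho sigma s T delta d x : R) :
  0 <= rho -> 0 <= sigma -> rho ^+ 2 + sigma ^+ 2 = 1 ->
  1 <= T -> - T <= s -> 0 <= delta <= rho / 2 -> x < - T ->
  (d%:E <= gamma `]s, (s + delta)%R]%classic)%E ->
  (threshold_section rho sigma s x + d%:E <= gamma `]s, +oo[%classic)%E.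
Proof.
move=> rho0 sigma0 rs T1 sT /andP[d0 dr] Tx dg.
apply: (@le_trans _ _ (gamma `](s + delta)%R, +oo[%classic + d%:E)%E); last first.
  rewrite [X in (_ <= gamma X)%E](@itv_bndbnd_setU _ _ _ (BRight (s + delta)))//;
    last by rewrite bnd_simp; lra.
  rewrite measureU//; first by rewrite addeC leeD2r.
  by apply/seteqP; split=> y //= -[]; rewrite !in_itv/= andbT => /andP[_ ys] sy; lra.
rewrite leeD2r// -[X in gamma X]setIT -integral_indic//.
apply: ge0_le_integral => //.
- exact: (measurable_ind_affine (rho * x) sigma s).
- by apply/measurable_EFinP; exact: measurable_ind_ray.
- move=> z _; rewrite lee_fin; apply: le_ind_ray; apply: contraTT.
  rewrite -!leNgt => zs.
  have := @le_threshold_line rho sigma (- s) T (- x) (- z) rho0 sigma0 rs T1.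
  rewrite !mulrN -!opprD !lerN2; apply; [by lra|by lra|].
  by apply: le_trans zs _; rewrite lerD2l.
Qed.

Lemma gaussian_threshold_setI n (w v : Rn R n) (t s : R) :
  dotp w w = 1 -> dotp v v = 1 ->
  exists2 sigma : R, 0 <= sigma /\ dotp w v ^+ 2 + sigma ^+ 2 = 1 &
    (gaussian n (threshold_set w t `&` threshold_set v s) =
     \int[gamma]_(x in `]t, +oo[) threshold_section (dotp w v) sigma s x)%E.
Proof.
move=> w1 v1; have [sigma [sigma0 rs] law] := gaussian_pair_integral _ w v w1.
rewrite v1 in rs; exists sigma => //.
pose h (p : MR * MR) := (ind t p.1 * ind s p.2)%:E.
have mh : measurable_fun [set: MR * MR] h.
  apply/measurable_EFinP; apply: measurable_funM.
    exact: (measurableT_comp (measurable_ind_ray t) measurable_fst).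
  exact: (measurableT_comp (measurable_ind_ray s) measurable_snd).
have mlin : measurable_fun [set: MR * MR]
    (fun z : MR * MR => (z.1, dotp w v * z.1 + sigma * z.2) : MR * MR).
  have := measurable_linear2_pair 1 0 (dotp w v) sigma.
  by apply: eq_measurable_fun => z _ /=; rewrite mul0r mul1r addr0.
transitivity (\int[gaussian n]_x h (dotp x w, dotp x v))%E.
  rewrite -[X in gaussian n X]setIT -integral_indic//; last first.
    by apply: measurableI; exact: measurable_threshold_set.
  apply: eq_integral => x _; rewrite /h/= indicI/= !threshold_setE.
  by rewrite !indicE !mem_setE.
rewrite (law _ mh).
have h0 p : (0 <= h p)%E by rewrite lee_fin mulr_ge0.
apply: etrans (fubini_tonelli1 _ (measurableT_comp mh mlin) (fun=> h0 _)) _.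
rewrite [RHS]integral_mkcond; apply: eq_integral => x _.
rewrite patchE mem_setE in_itv/= andbT /fubini_F /threshold_section /h/= ind_rayE.
case: ltP => tx /=.
  by apply: eq_integral => y _; rewrite mul1r.
by under eq_integral do rewrite mul0r; rewrite integral_cst//= mul0e.
Qed.

Lemma gaussian_threshold_set n (w : Rn R n) (t : R) : dotp w w = 1 ->
  gaussian n (threshold_set w t) = gamma `]t, +oo[%classic.
Proof.
move=> w1; have [sigma _ law] := gaussian_pair_integral _ w w w1.
have mk : measurable_fun [set: MR] (fun x : MR => (ind t x)%:E).
  by apply/measurable_EFinP; exact: measurable_ind_ray.
have mh : measurable_fun [set: MR * MR] (fun z : MR * MR => (ind t z.1)%:E).
  exact: (measurableT_comp mk measurable_fst).
transitivity (\int[gaussian n]_x (ind t (dotp x w))%:E)%E.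
  rewrite -[X in gaussian n X]setIT -integral_indic//; last first.
    exact: measurable_threshold_set.
  apply: eq_integral => x _; rewrite threshold_setE.
  by rewrite !indicE !mem_setE.
apply: etrans (law _ mh) _.
apply: etrans (fubini_tonelli1 _ mh (fun=> ind_ray_ge0 _ _)) _.
rewrite /fubini_F/=.
under eq_integral do rewrite integral_cst//= probability_setT mule1.
by rewrite integral_indic ?setIT.
Qed.

End threshold_sections.

(** * The covariance bound for a pair of threshold sets *)

Section covariance_lower_bound.
Context {R : realType}.
Local Notation MR := (measurableTypeR R).
Local Notation gamma := (normal_prob (0 : R) 1).
Local Notation phi := (normal_pdf (0 : R) 1).

Lemma covariance_indic (d : measure_display) (T : measurableType d)
    (P : probability T R) (A B : set T) : measurable A -> measurable B ->
  covariance P \1_A \1_B = (P (A `&` B) - P A * P B)%E.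
Proof.
move=> mA mB; rewrite covariance_indicE// !expectation_indic//.
rewrite (_ : (fun x => _) = \1_(A `&` B)); last by rewrite indicI.
by rewrite expectation_indic//; exact: measurableI.
Qed.

Lemma threshold_covariance_ge n (w v : Rn R n) (t s : R) :
  dotp w w = 1 -> dotp v v = 1 -> 0 <= dotp w v -> `|s| <= Num.max 1 `|t| ->
  ((expR (- (7 / 2)) / 2 * (dotp w v * (phi t * phi s) /
     (Num.max 1 `|t| * Num.max 1 `|s|)))%:E <=
   covariance (gaussian n) \1_(threshold_set w t) \1_(threshold_set v s))%E.
Proof.
move=> w1 v1 rho0 sT.
have [mA mB] := (measurable_threshold_set _ w t, measurable_threshold_set _ v s).
rewrite covariance_indic// !gaussian_threshold_set//.
have [sigma [sigma0 rs] ->] := gaussian_threshold_setI _ w v t s w1 v1.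
set rho := dotp w v in rho0 rs *; set T := Num.max 1 `|t| in sT *.
set b := Num.max 1 `|s|.
have T1 : 1 <= T by rewrite le_max lexx.
have tT : `|t| <= T by rewrite le_max lexx orbT.
have b1 : 1 <= b by rewrite le_max lexx.
have sb : `|s| <= b by rewrite le_max lexx orbT.
have b0 : 0 < b by apply: lt_le_trans b1.
have T0 : 0 < T by apply: lt_le_trans T1.
have bi1 : b^-1 <= 1 by rewrite invf_le1.
have bi0 : 0 < b^-1 by rewrite invr_gt0.
have rho1 : rho <= 1 by have := sqr_ge0 sigma; nra.
(* The strip must be no wider than [rho / 2] for the section bounds, and no wider than [b^-1] for
   the density on it to stay comparable to [phi s]. *)
pose delta := rho / 2 * b^-1.
have delta0 : 0 <= delta by rewrite mulr_ge0 ?divr_ge0// ltW.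
have delta_rho : delta <= rho / 2 by rewrite ler_piMr// divr_ge0.
have delta_b : delta <= b^-1 by rewrite ler_piMl ?ltW//; lra.
have delta_itv : 0 <= delta <= rho / 2 by rewrite delta0.
pose d := delta * (expR (- (3 / 2)) * phi s).
pose tau := T^-1 * (expR (- (3 / 2)) * phi T).
have phi0 := @standard_normal_pdf_gt0 R.
have d0 : 0 <= d by rewrite mulr_ge0// mulr_ge0 ?expR_ge0// ltW.
have tau0 : 0 <= tau by rewrite !mulr_ge0 ?invr_ge0 ?expR_ge0// ltW.
have [tauT tauNT] := normal_prob_tail_ge T T1.
have dl : (d%:E <= gamma `](s - delta)%R, s]%classic)%E.
  have := @normal_prob_itv_near R s b (s - delta) s false false b1 sb.
  by rewrite opprB addrCA subrr addr0; apply; lra.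
have dr : (d%:E <= gamma `]s, (s + delta)%R]%classic)%E.
  have := @normal_prob_itv_near R s b s (s + delta) false false b1 sb.
  by rewrite addrAC subrr add0r; apply; lra.
have /andP[sT1 sT2] : - T <= s <= T by rewrite -ler_norml.
pose p := fine (gamma `]s, +oo[%classic).
have pE : gamma `]s, +oo[%classic = p%:E by rewrite fineK// fin_num_measure.
have := @integral_tail_monotone_ge R gamma (threshold_section rho sigma s)
  p d tau t T (measurable_threshold_section _ _ _)
  (threshold_section_ge0 _ _ _) (fun x y => le_threshold_section _ _ _ x y rho0).
rewrite integral_threshold_section// => /(_ pE).
have p0 : 0 <= p by rewrite fine_ge0.
move=> /(_ p0 d0 tau0 tT).
have hG x : T < x -> ((p + d)%:E <= threshold_section rho sigma s x)%E.
  move=> Tx; rewrite EFinD -pE.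
  exact: (threshold_section_ge _ _ _ T delta).
have hG' x : x < - T -> (threshold_section rho sigma s x + d%:E <= p%:E)%E.
  by move=> Tx; rewrite -pE; exact: (threshold_section_le _ _ _ T delta).
move=> /(_ hG hG' tauT tauNT) main.
rewrite leeBrDr; last by rewrite fin_numM// fin_num_measure.
apply: le_trans main; rewrite addeC muleC pE leeD2l// lee_fin.
(* In both cases of the maximum, [T ^+ 2 <= t ^+ 2 + 1]. *)
have phitT : expR (- (1 / 2)) * phi t <= phi T.
  apply: standard_normal_pdf_ratio; rewrite /T.
  have t2 := sqr_ge0 t; case: (leP 1 `|t|) => _; rewrite ?real_normK ?num_real// ?expr1n; lra.
(* The strip and the tail each cost [expR (- (3 / 2))], and the passage from [T] to [t] costs
   [expR (- (1 / 2))]; the remaining factor [1 / 2] of the constant comes from [delta]. *)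
have -> : expR (- (7 / 2)) = expR (- (3 / 2)) * expR (- (3 / 2)) * expR (- (1 / 2)) :> R.
  by rewrite -!expRD; congr expR; field.
rewrite /d /tau /delta.
set E := expR (- (3 / 2)); set E' := expR (- (1 / 2)) in phitT *.
rewrite [leLHS](_ : _ = rho / 2 * b^-1 * T^-1 * E * E * phi s * (E' * phi t)); last first.
  by field; rewrite !gt_eqF.
rewrite [leRHS](_ : _ = rho / 2 * b^-1 * T^-1 * E * E * phi s * phi T); last by ring.
by rewrite ler_wpM2l// !mulr_ge0 ?expR_ge0 ?invr_ge0// ltW.
Qed.

Lemma dotpC n (w v : Rn R n) : dotp w v = dotp v w.
Proof. by apply: eq_bigr => i _; rewrite mulrC. Qed.

End covariance_lower_bound.

Theorem theorem3 (R : realType) :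
  exists2 c : R, 0 < c &
  forall (n : nat) (w v : Rn R n) (t s : R),
    norm2 w = 1 -> norm2 v = 1 ->
    let rho := dotp w v in
    let A := threshold_set w t in
    let B := threshold_set v s in
    0 <= rho ->
    ((c * (W1 A B / (Num.sqrt (ln (expR 1 / W1 A A)) *
                     Num.sqrt (ln (expR 1 / W1 B B)))))%:E
      <= covariance (gaussian n) \1_A \1_B)%E.
Proof.
(* The constant is that of [threshold_covariance_ge]: replacing the maxima by the larger square
   roots of logarithms loses nothing. *)
exists (expR (- (7 / 2)) / 2); first by rewrite divr_gt0// expR_gt0.
move=> n w v t s /norm2_dotp w1 /norm2_dotp v1 /= rho0.
rewrite !W1_threshold_set// w1 v1.
have phi0 := @standard_normal_pdf_gt0 R.
have max1_gt0 (x : R) : 0 < Num.max 1 `|x| by rewrite lt_max ltr01.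
set L := Num.sqrt _ * Num.sqrt _.
have leL : Num.max 1 `|t| * Num.max 1 `|s| <= L.
  by apply: ler_pM; rewrite ?(ltW (max1_gt0 _))//;
    exact: le_sqrt_ln_standard_normal_pdf.
have L0 : 0 < L by apply: lt_le_trans leL; rewrite mulr_gt0.
apply: (@le_trans _ _ (expR (- (7 / 2)) / 2 * (dotp w v * (normal_pdf 0 1 t * normal_pdf 0 1 s) /
    (Num.max 1 `|t| * Num.max 1 `|s|)))%:E).
  rewrite lee_fin ler_wpM2l ?divr_ge0 ?expR_ge0//.
  have num0 : 0 <= dotp w v * (normal_pdf 0 1 t * normal_pdf 0 1 s).
    by rewrite mulr_ge0// ltW// mulr_gt0.
  by rewrite ler_wpM2l// lef_pV2// posrE mulr_gt0.
(* Both sides are symmetric in the two sets, so they may be exchanged when [s] is the larger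
   threshold in absolute value. *)
have [st|/ltW ts] := leP `|s| (Num.max 1 `|t|).
  exact: threshold_covariance_ge.
have ts' : `|t| <= Num.max 1 `|s|.
  by move: ts; rewrite ge_max le_max => /andP[_ ->]; rewrite orbT.
rewrite covarianceC dotpC [normal_pdf 0 1 t * _]mulrC [Num.max 1 `|t| * _]mulrC.
by apply: threshold_covariance_ge => //; rewrite dotpC.
Qed.
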